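(* Let $n\in\mathbb{N}\setminus\{1,2\}$ and let $\Lambda_n(t,W)\in\mathcal{M}(\mathcal{O}_n)$ be a cyclotomic model set. Further, let $U\subset\mathbb{S}^1$ be an arbitrary, but fixed finite set of pairwise non-parallel $\mathcal{O}_n$-directions. Then, $\mathcal{F}(\Lambda_n(t,W))$ is not determined by the $X$-rays in the directions of $U$.
   Context: Identify $\mathbb{C}$ with $\mathbb{R}^2$. Let $\zeta_n=e^{2\pi i/n}$, $\mathbb{K}_n=\mathbb{Q}(\zeta_n)$, $\mathcal{O}_n=\mathbb{Z}[\zeta_n]$, and let $\phi$ be Euler's totient function. Cyclotomic model sets. For $n\in\mathbb{N}\setminus\{1,2\}$, choose exactly one automorphism from each pair of complex conjugate automorphisms in $\mathrm{Gal}(\mathbb{K}_n/\mathbb{Q})$, obtaining $\sigma_1=\mathrm{id},\sigma_2,\dots,\sigma_{\phi(n)/2}$. The associated star map $\star:\mathcal{O}_n\to(\mathbb{R}^2)^{\phi(n)/2-1}$ is $z\mapsto(\sigma_2(z),\dots,\sigma_{\phi(n)/2}(z))$; if $n\in\{3,4,6\}$, $(\mathbb{R}^2)^{0}$ is the trivial group $\{0\}$ and the star map is $0$. A window is a set $W\subset(\mathbb{R}^2)^{\phi(n)/2-1}$ with $\varnothing\neq W^\circ\subset W\subset\overline{W^\circ}$ and $\overline{W^\circ}$ compact. For a window $W$ and $t\in\mathbb{R}^2$ set $\Lambda_n(t,W)=t+\{z\in\mathcal{O}_n : z^\star\in W\}$. $\mathcal{M}(\mathcal{O}_n)$ is the collection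 of all sets $\Lambda_n(t,W)$ (all $t$, all windows $W$, all choices of star map); its elements are called cyclotomic model sets. $\mathcal{F}(S)$ denotes the set of all finite subsets of $S\subset\mathbb{R}^2$. A direction is an element of $\mathbb{S}^1$; an $\mathcal{O}_n$-direction is a direction parallel to a non-zero element of $\mathcal{O}_n$. For a finite $F\subset\mathbb{R}^2$ and a direction $u$, the $X$-ray $X_uF$ is the function assigning to each line $\ell$ parallel to $u$ the number $\operatorname{card}(F\cap\ell)$. A collection $\mathcal{E}$ of finite subsets of $\mathbb{R}^2$ is determined by the $X$-rays in the directions of a finite set $U$ of directions if for all $F,F'\in\mathcal{E}$: $(X_uF=X_uF'\ \forall u\in U)\Rightarrow F=F'$. *)

(* Defs.v *)
From HB Require Import structures.
From mathcomp Require Import all_boot all_order all_algebra finmap complex.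
From mathcomp Require Import all_classical all_reals all_analysis.

Set Implicit Arguments.
Unset Strict Implicit.
Unset Printing Implicit Defensive.

Import Order.TTheory GRing.Theory Num.Theory.
Import numFieldNormedType.Exports.

Local Open Scope classical_set_scope.
Local Open Scope ring_scope.
Local Open Scope complex_scope.

Section Cyclotomic.
Variables (R : realType) (n : nat).

(* [R[i]] plays the role of both C and the plane R^2. *)
Definition zeta : R[i] := cos (2 * pi / n%:R) +i* sin (2 * pi / n%:R).

Definition in_cyclotomic : {pred R[i]} :=
  fun z => `[< exists p q : {poly rat},
    (map_poly ratr q).[zeta] != 0 /\
    z = (map_poly ratr p).[zeta] / (map_poly ratr q).[zeta] >].

Lemma in_cyclotomic_divring : divring_closed in_cyclotomic.
Proof.
have hE (p q : {poly rat}) : (map_poly ratr (p * q)).[zeta] =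
    (map_poly ratr p).[zeta] * (map_poly ratr q).[zeta] :> R[i].
  by rewrite rmorphM hornerM.
split.
- apply/asboolP; exists 1, 1; rewrite rmorph1 hornerC divr1.
  by rewrite oner_neq0.
- move=> x y /asboolP [p [q [q0 ->]]] /asboolP [p' [q' [q'0 ->]]].
  apply/asboolP; exists (p * q' - p' * q), (q * q'); split.
    by rewrite hE mulf_neq0.
  rewrite rmorphB hornerD hornerN !hE.
  by rewrite -mulNr addf_div // mulNr.
- move=> x y /asboolP [p [q [q0 ->]]] /asboolP [p' [q' [q'0 ->]]].
  apply/asboolP.
  have [p'0|p'0] := eqVneq (map_poly ratr p').[zeta] (0 : R[i]).
    exists 0, 1; rewrite p'0 !mul0r invr0 mulr0 rmorph0 rmorph1 horner0 mul0r.
    by rewrite hornerC oner_neq0.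
  exists (p * q'), (q * p'); rewrite !hE mulf_neq0 //; split => //.
  by rewrite invf_div mulf_div.
Qed.

HB.instance Definition _ :=
  GRing.isDivringClosed.Build R[i] in_cyclotomic in_cyclotomic_divring.

Record cyclotomic : Type := Cyclotomic {
  cyclotomic_val :> R[i];
  cyclotomic_valP : cyclotomic_val \in in_cyclotomic }.

HB.instance Definition _ := [isSub for cyclotomic_val].
HB.instance Definition _ := [Choice of cyclotomic by <:].
HB.instance Definition _ := [SubChoice_isSubComUnitRing of cyclotomic by <:].
HB.instance Definition _ :=
  [SubComUnitRing_isSubIntegralDomain of cyclotomic by <:].
HB.instance Definition _ := [SubIntegralDomain_isSubField of cyclotomic by <:].

Definition cyclotomic_int : set R[i] :=
  [set z | exists p : {poly int}, z = (map_poly intr p).[zeta]].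

Definition cyclotomic_gal (s : {rmorphism cyclotomic -> cyclotomic}) : Prop :=
  bijective s /\ forall q : rat, s (ratr q) = ratr q.

Definition conjugate_to (s tau : {rmorphism cyclotomic -> cyclotomic}) : Prop :=
  forall x, \val (s x) = (\val (tau x))^*.

Definition star_dim : nat := (totient n)./2.-1.

(* With 0-based indices, [s ord0] is sigma_1 = id; since phi(n)/2 >= 1 for
   n > 2, the index type has exactly phi(n)/2 elements. *)
Definition star_choice
    (s : 'I_star_dim.+1 -> {rmorphism cyclotomic -> cyclotomic}) : Prop :=
  [/\ s ord0 =1 id,
      forall i, cyclotomic_gal (s i)
    & forall tau, cyclotomic_gal tau ->
        exists! i, s i =1 tau \/ conjugate_to (s i) tau].

(* [R[i]^o] is [R[i]] with the topology of its norm, i.e. that of R^2; row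
   vectors carry the product topology, and there is a single one of length 0. *)
Definition star (s : 'I_star_dim.+1 -> {rmorphism cyclotomic -> cyclotomic})
    (z : cyclotomic) : 'rV[R[i]^o]_star_dim :=
  \row_i \val (s (lift ord0 i) z).

Definition window (W : set 'rV[R[i]^o]_star_dim) : Prop :=
  [/\ W° !=set0, W° `<=` W, W `<=` closure W° & compact (closure W°)].

Definition model_set (s : 'I_star_dim.+1 -> {rmorphism cyclotomic -> cyclotomic})
    (t : R[i]) (W : set 'rV[R[i]^o]_star_dim) : set R[i] :=
  [set t + \val z | z in
    [set z : cyclotomic | cyclotomic_int (\val z) /\ W (star s z)]].

Definition cyclotomic_model_sets : set (set R[i]) :=
  [set L | exists s t W, [/\ star_choice s, window W & L = model_set s t W]].

End Cyclotomic.

Section Xray.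
Variable R : realType.

Definition direction (u : R[i]) : Prop := `|u| = 1.

Definition parallel (u v : R[i]) : Prop := exists2 r : R, r != 0 & u = r%:C * v.

Definition cyclotomic_direction (n : nat) (u : R[i]) : Prop :=
  direction u /\
  exists z, [/\ cyclotomic_int n z, z != 0 & parallel u z].

Definition line_along (u : R[i]) (l : set R[i]) : Prop :=
  exists p, l = [set p + r%:C * u | r in [set: R]].

Definition xray (u : R[i]) (F : {fset R[i]}) : {l | line_along u l} -> nat :=
  fun l => #|` [fset z in F | z \in sval l]%fset|.
Arguments xray : clear implicits.

Definition finite_subsets (S : set R[i]) : set {fset R[i]} :=
  [set F : {fset R[i]} | [set` F] `<=` S].

Definition determined (E : set {fset R[i]}) (U : {fset R[i]}) : Prop :=
  forall F F', E F -> E F' ->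
    (forall u, u \in U -> xray u F = xray u F') -> F = F'.

End Xray.

Arguments xray {R} u F _.

(* Main.v *)
Require Import Defs.
From mathcomp Require Import all_boot all_order all_algebra finmap complex.
From mathcomp Require Import all_classical all_reals all_analysis.
From mathcomp Require Import zify ring lra.

Set Implicit Arguments.
Unset Strict Implicit.
Unset Printing Implicit Defensive.

Import Order.TTheory GRing.Theory Num.Theory.
Import numFieldNormedType.Exports.

Local Open Scope ring_scope.
Local Open Scope complex_scope.

(** The idea is to build, inside the model set, two disjoint finite sets F and
    F' that no direction of U can tell apart.

    Start from a single point and the empty set and treat the directions u of
    U one after the other.  If F and F' already have equal X-rays in the
    earlier directions and v is parallel to u, then F + (F' + v) and
    F' + (F + v) still do, and they also have equal X-rays along u, because
    translating by v moves every line parallel to u to itself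
    ([switching_component]).  All this needs is a supply of translations: for
    each finite subset of the model set and each u, a vector v parallel to u
    that keeps the subset inside the model set and moves it off itself.

    Shrinking the window to its interior, a finite subset stays inside under
    every translation by an element of Z[zeta] whose star image is small
    enough ([model_set_shift]).  So what is wanted is a real multiple of a
    given nonzero element of Z[zeta] with small star image
    ([small_multiple]), and also one point of Z[zeta] with star image in the
    interior of the window, to start from ([model_set_nonempty]).

    Both come from one Diophantine fact, [small_conjugates]: Z[zeta] contains
    nonzero elements all of whose conjugates, apart from the element itself
    and its complex conjugate, are as small as desired.  To get one, take the
    monic real polynomial P whose roots are the conjugates x_i of zeta other
    than zeta and its complex conjugate, and find by Dirichlet's pigeonhole
    argument a positive integer T for which T P is close to an integer
    polynomial q.  Then the q(x_i) are small since P(x_i) = 0; and q cannot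
    vanish at zeta, for it would then vanish at all conjugates of zeta, which
    are more numerous than its degree.
    - Multiplying q(zeta) by its complex conjugate gives a real element, still
      with small conjugates; its integer multiples times the given element
      provide [small_multiple].
    - For density ([dense_conjugates]), interpolate the target values, divided
      by the q(x_i), by a real polynomial, round its coefficients down to
      integers and multiply by q: the rounding error is bounded independently
      of q, and the factor q makes it small.

    That zeta has enough conjugates is read off the star map.  If two of the
    chosen automorphisms agreed at zeta, possibly after complex conjugation,
    they would agree on the whole field in the same sense, against the choice
    of exactly one in each pair ([conjugates_inj], [conjugates_neq_conj]); and
    a rational relation satisfied by zeta is satisfied by all its images. *)

(** * Simultaneous Diophantine approximation *)

(** Among K ^ m + 1 multiples of the point c, two have fractional parts in the
    same box of side 1 / K; T is the difference of the two multipliers. *)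
Lemma dirichlet (R : realType) (m K : nat) (c : 'I_m -> R) : (0 < K)%N ->
  exists (T : nat) (a : 'I_m -> int), (0 < T)%N /\
    forall j, `|T%:R * c j - (a j)%:~R| <= K%:R^-1.
Proof.
move=> K_gt0.
have K_gt0r : 0 < K%:R :> R by rewrite ltr0n.
pose fl (x : R) := Num.floor x.
pose fr (t : nat) j : R := t%:R * c j - (fl (t%:R * c j))%:~R.
have fr0 t j : 0 <= fr t j by rewrite subr_ge0 floor_le.
have fr1 t j : fr t j < 1.
  by rewrite ltrBlDr addrC -[1]/(1%:~R) -intrD floorD1_gt.
have boxP t j : (Num.truncn (K%:R * fr t j) < K)%N.
  rewrite -(ltr_nat R); apply: (@le_lt_trans _ _ (K%:R * fr t j)).
    by rewrite truncn_le // mulr_ge0 // ltW.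
  by rewrite -[ltRHS]mulr1 ltr_pM2l.
pose box (t : 'I_(K ^ m).+1) : {ffun 'I_m -> 'I_K} :=
  [ffun j => Ordinal (boxP t j)].
have /injectivePn [t1 [t2 neq_t eq_box]] : ~~ injectiveb box.
  by apply/negP => /injectiveP/leq_card; rewrite card_ffun !card_ord ltnn.
wlog lt_t : t1 t2 neq_t eq_box / (t1 < t2)%N.
  case: (ltngtP t1 t2) => [lt | lt | /val_inj eq] H.
  - exact: (H t1 t2).
  - by apply: (H t2 t1) => //; rewrite eq_sym.
  - by rewrite eq eqxx in neq_t.
exists (t2 - t1)%N, (fun j => fl (t2%:R * c j) - fl (t1%:R * c j)).
split=> [|j]; first by rewrite subn_gt0.
have -> : (t2 - t1)%:R * c j - (fl (t2%:R * c j) - fl (t1%:R * c j))%:~R =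
          fr t2 j - fr t1 j.
  by rewrite natrB ?(ltnW lt_t) // rmorphB /= /fr; ring.
have /ffunP/(_ j) := eq_box; rewrite !ffunE => /(congr1 val) /= eqj.
have itv t : let k := Num.truncn (K%:R * fr t j) in
    k%:R <= K%:R * fr t j < k.+1%:R.
  by apply: truncn_itv; rewrite mulr_ge0 // ltW.
move: (itv t1) (itv t2); rewrite /= eqj => /andP[l1 u1] /andP[l2 u2].
rewrite -(ler_pM2l K_gt0r) divff ?gt_eqF // -[X in X * _](gtr0_norm K_gt0r).
rewrite -normrM mulrBr ler_norml; move: u1 u2; rewrite -natr1; lra.
Qed.

(** * X-rays and switching components *)

Section Switching.
Variable R : realType.
Implicit Types (F G : {fset R[i]}) (u v : R[i]).

Definition shift v F : {fset R[i]} := [fset (x + v)%R | x in F]%fset.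

Lemma card_shift v F (P Q : pred R[i]) : (forall x, P (x + v) = Q x) ->
  #|` [fset z in shift v F | P z]%fset| = #|` [fset z in F | Q z]%fset|.
Proof.
move=> PQ.
have -> : [fset z in shift v F | P z]%fset = shift v [fset z in F | Q z]%fset.
  apply/fsetP => z; rewrite !inE; apply/andP/imfsetP => /=.
    case=> /imfsetP[x /= xF ->]; rewrite PQ => Qx.
    by exists x; rewrite ?inE ?xF.
  case=> x; rewrite !inE => /andP[xF Qx] ->; split; last by rewrite PQ.
  by apply/imfsetP; exists x.
by rewrite card_imfset //; apply: addIr.
Qed.

Lemma card_filter_disjointU F G (P : pred R[i]) : [disjoint F & G]%fset ->
  #|` [fset z in F `|` G | P z]%fset| =
  (#|` [fset z in F | P z]%fset| + #|` [fset z in G | P z]%fset|)%N.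
Proof.
move=> dFG.
have -> : [fset z in F `|` G | P z]%fset =
    ([fset z in F | P z] `|` [fset z in G | P z])%fset.
  by apply/fsetP => z; rewrite !inE; case: (P z); rewrite ?andbT ?andbF.
rewrite cardfsU (_ : (_ `&` _)%fset = fset0) ?cardfs0 ?subn0 //.
apply/fsetP => z; rewrite !inE.
have /fsetP/(_ z) := (elimT eqP dFG : (F `&` G = fset0)%fset).
by rewrite !inE; case: (P z); rewrite ?andbT ?andbF.
Qed.

(** Translation by [- v] maps the lines parallel to [u] to one another. *)
Lemma xray_shift v F G u : xray u F = xray u G ->
  xray u (shift v F) = xray u (shift v G).
Proof.
move=> eqFG; apply/funext => -[l [p l_eq]]; rewrite /xray /=.
pose l' : set R[i] := [set p - v + r%:C * u | r in [set: R]]%classic.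
have l'P : line_along u l' by exists (p - v).
have mem_l x : (x + v \in l) = (x \in l').
  rewrite l_eq; apply/idP/idP => /set_mem[r _ rE]; apply/mem_set;
    exists r => //.
    by rewrite addrAC rE addrK.
  by rewrite -rE addrAC addrNK.
rewrite !(card_shift _ mem_l).
by have /(congr1 (fun f => f (exist _ l' l'P))) := eqFG.
Qed.

(** Every line parallel to [u] is invariant under this translation. *)
Lemma xray_shift_along (r : R) F u : xray u (shift (r%:C * u) F) = xray u F.
Proof.
apply/funext => -[l [p l_eq]]; rewrite /xray /=; apply: card_shift => x.
rewrite l_eq; apply/idP/idP => /set_mem[s _ sE]; apply/mem_set.
  by exists (s - r) => //; rewrite rmorphB mulrBl addrA sE addrK.
by exists (s + r) => //; rewrite rmorphD mulrDl addrA sE.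
Qed.

Lemma xray_disjointU u F G F' G' :
  [disjoint F & G]%fset -> [disjoint F' & G']%fset ->
  xray u F = xray u F' -> xray u G = xray u G' ->
  xray u (F `|` G)%fset = xray u (F' `|` G')%fset.
Proof.
move=> dFG dFG' eF eG; apply/funext => l.
rewrite /xray !card_filter_disjointU //.
by congr (_ + _)%N; [move: eF | move: eG] => /(congr1 (fun f => f l)).
Qed.

(** Induction on the directions: a pair [F], [F'] that agrees on the others is
    replaced by [F `|` (F' + v)], [F' `|` (F + v)] with [v] parallel to the new
    one.  The translation is chosen after the pair, off which it has to move,
    so the hypothesis only has to provide one translation for each finite
    set and direction. *)
Lemma switching_component (S : set R[i]) (U : seq R[i]) :
  (S !=set0)%classic ->
  (forall F u, finite_subsets S F -> u \in U -> exists r : R,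
     forall x, x \in F -> S (x + r%:C * u) /\ x + r%:C * u \notin F) ->
  exists F F', [/\ finite_subsets S F, finite_subsets S F',
     [disjoint F & F']%fset, F != fset0 &
     forall u, u \in U -> xray u F = xray u F'].
Proof.
move=> [x0 Sx0]; elim: U => [_|u U IH step].
  exists [fset x0]%fset, fset0; split => //.
  - by move=> x /= /fset1P ->.
  - exact: fdisjointX0.
  - by apply/fset0Pn; exists x0; rewrite inE.
have {IH}[|F [F' [SF SF' dF F0 eqF]]] := IH.
  by move=> F v SF vU; apply: step; rewrite // inE vU orbT.
have SFF' : finite_subsets S (F `|` F')%fset.
  by move=> x /= /fsetUP[/SF|/SF'].
have [r rP] := step _ u SFF' (mem_head _ _).
set v := r%:C * u in rP.
have S_shift (G : {fset R[i]}) : (G `<=` F `|` F')%fset ->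
    finite_subsets S (shift v G).
  by move=> /fsubsetP sG x /= /imfsetP[y /= /sG /rP[Sy _] ->].
have d_shift (G H : {fset R[i]}) : (G `<=` F `|` F')%fset ->
    (H `<=` F `|` F')%fset -> [disjoint G & shift v H]%fset.
  move=> /fsubsetP sG /fsubsetP sH; apply/fdisjointP => x /sG xF.
  by apply/imfsetP => -[y /= /sH /rP[_ /negP nF] eq]; apply: nF; rewrite -eq.
have sF : (F `<=` F `|` F')%fset := fsubsetUl _ _.
have sF' : (F' `<=` F `|` F')%fset := fsubsetUr _ _.
exists (F `|` shift v F')%fset, (F' `|` shift v F)%fset; split.
- by move=> x /= /fsetUP[/SF //|]; apply: S_shift.
- by move=> x /= /fsetUP[/SF' //|]; apply: S_shift.
- rewrite fdisjointUX !fdisjointXU dF d_shift //= fdisjoint_sym d_shift //=.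
  apply/fdisjointP => _ /imfsetP[x /= xF' ->].
  apply/imfsetP => -[y /= yF /addIr eq].
  by move/fdisjointP: dF => /(_ _ yF); rewrite -eq xF'.
- by case/fset0Pn: F0 => x xF; apply/fset0Pn; exists x; rewrite inE xF.
move=> w; rewrite inE => /predU1P[->|wU].
  rewrite [in RHS]fsetUC; apply: xray_disjointU; rewrite ?d_shift //.
  - by rewrite fdisjoint_sym d_shift.
  - by rewrite xray_shift_along.
  - by rewrite xray_shift_along.
apply: xray_disjointU; rewrite ?d_shift //; first exact: eqF.
by apply: xray_shift; rewrite eqF.
Qed.

End Switching.

(** * Polynomials at points of the unit circle *)

Local Notation evZ p z := (map_poly intr p).[z].

Section Approximation.
Variable R : realType.
Implicit Types (z : R[i]) (p : {poly int}) (P : {poly R}).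

Local Notation evR P z := (map_poly (real_complex R) P).[z].

Lemma evZ_conj p z : evZ p z^* = (evZ p z)^*.
Proof.
rewrite -[in RHS]horner_map /= -map_poly_comp /=; congr (_.[_]).
by apply: eq_map_poly => a /=; rewrite rmorph_int.
Qed.

Lemma evR_evZ_dist P p z (B : nat) (e : R) : `|z| <= 1 ->
  (size P <= B)%N -> (size p <= B)%N ->
  (forall j, (j < B)%N -> `|P`_j - (p`_j)%:~R| <= e) ->
  `|evR P z - evZ p z| <= (e *+ B)%:C.
Proof.
move=> z1 sP sp coefP.
have -> : evR P z = \sum_(j < B) (P`_j)%:C * z ^+ j.
  rewrite (@horner_coef_wide _ B) ?(leq_trans (size_poly _ _)) //.
  by apply: eq_bigr => j _; rewrite coef_map.
have -> : evZ p z = \sum_(j < B) (p`_j)%:~R * z ^+ j.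
  rewrite (@horner_coef_wide _ B) ?(leq_trans (size_poly _ _)) //.
  by apply: eq_bigr => j _; rewrite coef_map.
rewrite -sumrB; apply: le_trans (ler_norm_sum _ _ _) _.
rewrite rmorphMn /= -[X in _ *+ X]card_ord -sumr_const; apply: ler_sum => j _.
rewrite -mulrBl normrM normrX -[leRHS]mulr1 ler_pM ?exprn_ge0 ?exprn_ile1 //.
rewrite -[in X in _ - X](rmorph_int (real_complex R)) -rmorphB /=.
by rewrite normc_def /= expr0n /= addr0 sqrtr_sqr lecR coefP.
Qed.

(** The real polynomial with roots [z] and its conjugate: products of these
    vanish at prescribed nonreal points while keeping real coefficients. *)
Definition quadratic z : {poly R} :=
  'X^2 - (complex.Re z *+ 2) *: 'X + (complex.Re z ^+ 2 + complex.Im z ^+ 2)%:P.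

Lemma map_quadratic z :
  map_poly (real_complex R) (quadratic z) = ('X - z%:P) * ('X - z^*%:P).
Proof.
rewrite rmorphD rmorphB /= map_polyXn map_polyZ /= map_polyX map_polyC /=.
have -> : (complex.Re z *+ 2)%:C = z + z^*.
  by rewrite addcJ rmorphMn /= mulr_natl.
have -> : (complex.Re z ^+ 2 + complex.Im z ^+ 2)%:C = z * z^*.
  by rewrite add_Re2_Im2 sqr_normc.
by rewrite -mul_polyC polyCD polyCM; ring.
Qed.

Lemma size_quadratic z : size (quadratic z) = 3.
Proof.
rewrite -(size_map_poly (real_complex R)) map_quadratic.
by rewrite size_monicM ?monicXsubC ?polyXsubC_eq0 // !size_XsubC.
Qed.

Lemma monic_quadratic z : quadratic z \is monic.
Proof.
rewrite -(map_monic (real_complex R)) map_quadratic.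
by rewrite monicMl ?monicXsubC.
Qed.

Lemma evR_quadratic z z' : evR (quadratic z) z' = (z' - z) * (z' - z^*).
Proof. by rewrite map_quadratic hornerM !hornerXsubC. Qed.

(** Real affine functions of a nonreal number reach all complex values. *)
Lemma evR_linear z (c : R[i]) : z != z^* -> exists a b : R, a%:C + b%:C * z = c.
Proof.
case: z c => [x y] [c d] /eqP nreal.
have y0 : y != 0 by apply: contra_notN nreal => /eqP ->; rewrite /= oppr0.
exists (c - d / y * x), (d / y).
by apply/eqP; rewrite eq_complex /=; apply/andP; split; apply/eqP; field.
Qed.

(** In the application [y0] is zeta and the [y i] are its images under the
    remaining automorphisms of the star map.  The conjugates of these images
    are further nodes, at which real polynomials are controlled for free. *)
Section Nodes.
Variables (d : nat) (y0 : R[i]) (y : 'I_d -> R[i]).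
Hypothesis y_norm : forall i, `|y i| = 1.
Hypothesis y_inj : injective y.
Hypothesis y_conj : forall i j, y i != (y j)^*.

(** Lagrange interpolation at the nodes and their conjugates, with real
    coefficients: the usual products of linear factors become products of
    quadratic ones, and the scalar in front of each becomes a real affine
    factor.  What matters is that the degree bound is uniform in the values. *)
Lemma interpolation : exists B : nat, forall w : 'I_d -> R[i],
  exists2 P : {poly R}, (size P <= B)%N & forall i, evR P (y i) = w i.
Proof.
pose e k := \prod_(i | i != k) quadratic (y i).
have e_other k i : i != k -> evR (e k) (y i) = 0.
  move=> ik; rewrite /e rmorph_prod horner_prod (bigD1 i) //=.
  by rewrite evR_quadratic subrr !mul0r.
have e_self k : evR (e k) (y k) != 0.
  rewrite /e rmorph_prod horner_prod; apply/prodf_neq0 => i ik.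
  rewrite evR_quadratic mulf_neq0 // subr_eq0 ?y_conj //.
  by apply: contra ik => /eqP/y_inj ->.
pose B : nat := (\max_(k < d) (size (e k)).+1)%N.
exists B => w.
pose c k := w k / evR (e k) (y k).
have /choice[ab abP] : forall k,
    exists ab : R * R, ab.1%:C + ab.2%:C * y k = c k.
  move=> k; have [a [b abk]] := evR_linear (c k) (y_conj k k).
  by exists (a, b).
pose a k := (ab k).1; pose b k := (ab k).2.
exists (\sum_k (b k *: 'X + (a k)%:P) * e k).
  apply: leq_trans (size_sum _ _ _) _; apply/bigmax_leqP => k _.
  apply: leq_trans (leq_bigmax k); apply: leq_trans (size_polyMleq _ _) _.
  rewrite -subn1 leq_subLR -[in leqRHS]addSnnS leq_add2r -mul_polyC.
  by rewrite size_MXaddC; case: ifP => // _; rewrite ltnS size_polyC_leq1.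
move=> i; rewrite rmorph_sum horner_sum (bigD1 i) //=.
rewrite big1 => [|k ki]; last first.
  by rewrite rmorphM hornerM e_other ?mulr0 // eq_sym.
rewrite addr0 rmorphM rmorphD /= map_polyZ map_polyX map_polyC /= hornerM.
by rewrite !hornerE addrC abP /c divfK.
Qed.

Hypothesis y0_y : forall i, y0 != y i.
Hypothesis y0_conj : forall i, y0 != (y i)^*.
Hypothesis conjugates : forall p i, (evZ p y0 == 0) = (evZ p (y i) == 0).

(** An integer polynomial close to a positive multiple of the real polynomial
    with roots the [y i] and their conjugates.  It has degree [d.*2] because
    that polynomial is monic, so it cannot vanish at [y0] as well as at all the
    other nodes. *)
Lemma small_conjugates (e : R) : 0 < e ->
  exists2 p : {poly int}, evZ p y0 != 0 & forall i, `|evZ p (y i)| <= e%:C.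
Proof.
move=> e0; pose P := \prod_i quadratic (y i).
have P_monic : P \is monic by apply: monic_prod => i _; apply: monic_quadratic.
have sP : size P = d.*2.+1.
  rewrite size_prod => [|i _]; last by rewrite -size_poly_eq0 size_quadratic.
  under eq_bigr do rewrite size_quadratic.
  by rewrite sum_nat_const !card_ord -addnn; lia.
have P_node i : evR P (y i) = 0.
  rewrite /P rmorph_prod horner_prod (bigD1 i) //=.
  by rewrite evR_quadratic subrr !mul0r.
pose K := (Num.bound (d.*2.+1%:R / e)).+1.
have [T [a [T0 aP]]] := @dirichlet R d.*2 K (fun j => P`_j) isT.
(* Only the coefficients below the leading one need rounding: the leading
   coefficient of T P is the integer T. *)
pose q : {poly int} :=
  \poly_(j < d.*2.+1) if insub j is Some k then a k else T%:Z.
have sq : size q = d.*2.+1.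
  by rewrite size_poly_eq // insubF ?ltnn //; case: T T0 {aP q}.
have q_small i : `|evZ q (y i)| <= e%:C.
  have -> : evZ q (y i) = - (evR (T%:R *: P) (y i) - evZ q (y i)).
    by rewrite map_polyZ hornerZ P_node mulr0 sub0r opprK.
  rewrite normrN.
  apply: le_trans (@evR_evZ_dist _ _ _ d.*2.+1 K%:R^-1 _ _ _ _) _.
  - by rewrite y_norm.
  - by rewrite (leq_trans (size_scale_leq _ _)) ?sP.
  - by rewrite sq.
  - move=> j; rewrite ltnS coefZ coef_poly ltnS => le_j; rewrite le_j.
    case: insubP => [k _ kj|]; first by rewrite -kj; apply: aP.
    rewrite -leqNgt => ge_j.
    have -> : j = d.*2 by apply/eqP; rewrite eqn_leq le_j.
    have : P`_(d.*2) = 1 by move/monicP: P_monic; rewrite lead_coefE sP.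
    by move=> ->; rewrite mulr1 subrr normr0 invr_ge0.
  rewrite lecR -[_ *+ d.*2.+1]mulr_natl ler_pdivrMr ?ltr0n // mulrC.
  rewrite -ler_pdivrMr //.
  apply: ltW; apply: lt_trans (archi_boundP _) _.
    by rewrite divr_ge0 ?ltW.
  by rewrite ltr_nat.
exists q => //; apply/negP => q_y0.
pose rs := y0 :: [seq y i | i : 'I_d] ++ [seq (y i)^* | i : 'I_d].
(* q has the [d.*2.+1] distinct roots [rs], more than its degree. *)
have := @max_poly_roots _ (map_poly intr q : {poly R[i]}) rs.
rewrite size_map_inj_poly ?mulr0z //; last exact: intr_inj.
have -> : size rs = d.*2.+1 by rewrite /= size_cat !size_image card_ord addnn.
rewrite sq ltnn => H; apply: notF; apply: H.
- rewrite -size_poly_eq0 size_map_inj_poly ?sq //; exact: intr_inj.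
- rewrite /= all_cat /root q_y0 /=.
  apply/andP; split; apply/allP => x /mapP[i _ ->].
    by rewrite -conjugates.
  by rewrite evZ_conj conjc_eq0 -conjugates.
- rewrite /= mem_cat negb_or cat_uniq; apply/and4P; split.
  + apply/andP; split; apply/mapP => -[i _] /eqP; apply/negP => //.
  + by rewrite map_inj_uniq ?enum_uniq.
  + apply/hasPn => x /mapP[i _ ->]; apply/mapP => -[j _] /esym/eqP.
    exact/negP.
  + rewrite map_inj_uniq ?enum_uniq // => i j /(can_inj (@conjcK _)).
    exact: y_inj.
Qed.

(** Rounding the coefficients of an interpolating polynomial down to integers
    costs at most [B] at each node, however large the interpolated values; so
    it is harmless to divide these by the tiny numbers q(y_i) first and to
    multiply the result by q afterwards. *)
Lemma dense_conjugates (w : 'I_d -> R[i]) (e : R) : 0 < e ->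
  exists p : {poly int}, forall i, `|evZ p (y i) - w i| <= e%:C.
Proof.
move=> e0; have [B BP] := interpolation.
have [q q0 qP] := @small_conjugates (e / B.+1%:R) (divr_gt0 e0 (ltr0Sn _ _)).
have [P sP Pw] := BP (fun i => w i / evZ q (y i)).
pose p : {poly int} := \poly_(j < B) Num.floor P`_j.
exists (q * p) => i.
have qi : evZ q (y i) != 0 by rewrite -conjugates.
have -> : evZ (q * p) (y i) - w i =
          - (evZ q (y i) * (evR P (y i) - evZ p (y i))).
  by rewrite Pw rmorphM hornerM mulrBr mulrCA divff // mulr1 opprB.
rewrite normrN normrM.
have ePp : `|evR P (y i) - evZ p (y i)| <= (1 *+ B)%:C.
  apply: evR_evZ_dist => [||| j jB]; rewrite ?y_norm ?size_poly //.
  rewrite coef_poly jB ger0_norm ?subr_ge0 ?floor_le // lerBlDr addrC.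
  by rewrite -[1]/(1%:~R) -intrD ltW // floorD1_gt.
apply: le_trans (ler_pM _ _ (qP i) ePp) _ => //.
rewrite -rmorphM lecR -mulrA ler_piMr ?(ltW e0) // [_^-1 * _]mulrC.
rewrite ler_pdivrMr ?ltr0n //.
by rewrite mul1r ler_nat.
Qed.

End Nodes.
End Approximation.

(** * Conjugates of zeta *)

Section RootOfUnity.
Variables (R : realType) (n : nat).
Hypothesis n_gt2 : (2 < n)%N.

Lemma de_moivre (a : R) k :
  (cos a +i* sin a) ^+ k = cos (a *+ k) +i* sin (a *+ k).
Proof.
elim: k => [|k IH]; first by rewrite expr0 mulr0n cos0 sin0.
rewrite exprS IH mulrS cosD sinD.
by apply/eqP; rewrite eq_complex /=; apply/andP; split; apply/eqP; ring.
Qed.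

Lemma zeta_expn : zeta R n ^+ n = 1.
Proof.
rewrite de_moivre -[_ *+ n]mulr_natr.
rewrite divfK ?pnatr_eq0 -?lt0n ?(ltn_trans _ n_gt2) //.
by rewrite mulrC mulr_natr cos2pi sin2pi.
Qed.

Lemma zeta_sqr_neq1 : zeta R n ^+ 2 != 1.
Proof.
have pi0 := pi_gt0 R.
have n0 : 0 < n%:R :> R by rewrite ltr0n (ltn_trans _ n_gt2).
have s0 : 0 < sin (2 * pi / n%:R : R).
  apply: sin_gt0_pi; apply/andP; split; first by rewrite divr_gt0 // mulr_gt0.
  by rewrite ltr_pdivrMr // mulrC ltr_pM2l // (ltr_nat R 2).
apply/eqP => /(congr1 (fun z => complex.Re z)).
rewrite de_moivre mulr2n cosD /= -!expr2 => eq1.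
have := cos2Dsin2 (2 * pi / n%:R : R); nra.
Qed.

Lemma zeta_in : zeta R n \in in_cyclotomic n.
Proof.
apply/asboolP; exists 'X, 1.
by rewrite rmorph1 map_polyX hornerX hornerC oner_neq0 divr1.
Qed.

Definition zeta_cyc : cyclotomic R n := Cyclotomic zeta_in.

(** Elements of Z[zeta] are handled through integer polynomials, since an
    automorphism then only changes the evaluation point. *)
Definition cyc_of_poly (p : {poly int}) : cyclotomic R n := evZ p zeta_cyc.

Lemma val_morph_poly (s : {rmorphism cyclotomic R n -> cyclotomic R n}) p :
  \val (s (cyc_of_poly p)) = evZ p (\val (s zeta_cyc)).
Proof.
rewrite /cyc_of_poly -!horner_map -!map_poly_comp; congr (_.[_]).
by apply: eq_map_poly => a; rewrite -[LHS]/(\val (s a%:~R)) !rmorph_int.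
Qed.

Lemma val_cyc_of_poly p : \val (cyc_of_poly p) = evZ p (zeta R n).
Proof. exact: (val_morph_poly idfun). Qed.

(** Field morphisms are injective, so the images of zeta satisfy exactly the
    integral relations that zeta satisfies. *)
Lemma conjugates_morph (s : {rmorphism cyclotomic R n -> cyclotomic R n}) p :
  (evZ p (zeta R n) == 0) = (evZ p (\val (s zeta_cyc)) == 0).
Proof.
have val_eq0 (x : cyclotomic R n) : (\val x == 0) = (x == 0).
  by rewrite -(rmorph0 (\val : cyclotomic R n -> R[i])) (inj_eq val_inj).
by rewrite -val_cyc_of_poly -val_morph_poly !val_eq0 fmorph_eq0.
Qed.

Lemma conjugate_expn (s : {rmorphism cyclotomic R n -> cyclotomic R n}) :
  \val (s zeta_cyc) ^+ n = 1.
Proof.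
have zn : zeta_cyc ^+ n = 1.
  by apply: val_inj; rewrite rmorphXn rmorph1 zeta_expn.
by rewrite -rmorphXn -rmorphXn zn !rmorph1.
Qed.

Lemma conjugate_norm (s : {rmorphism cyclotomic R n -> cyclotomic R n}) :
  `|\val (s zeta_cyc)| = 1.
Proof.
apply/eqP; rewrite -(@pexpr_eq1 _ _ n) ?(ltn_trans _ n_gt2) //.
by rewrite -normrX conjugate_expn normr1.
Qed.

(** Complex conjugation acts on each image of zeta as the same power map, hence
    commutes with the automorphisms of the field. *)
Lemma conjugate_conj (s : {rmorphism cyclotomic R n -> cyclotomic R n}) :
  (\val (s zeta_cyc))^* = \val (s zeta_cyc) ^+ n.-1.
Proof.
set z := \val _.
have z0 : z != 0 by rewrite -normr_eq0 conjugate_norm oner_neq0.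
apply: (mulfI z0); rewrite -exprS prednK ?(ltn_trans _ n_gt2) // conjugate_expn.
by rewrite -sqr_normc conjugate_norm expr1n.
Qed.

(** A real number of modulus one has square 1, and this relation would transfer
    back to zeta, whose order [n] is larger than 2. *)
Lemma conjugate_nonreal (s : {rmorphism cyclotomic R n -> cyclotomic R n}) :
  \val (s zeta_cyc) != (\val (s zeta_cyc))^*.
Proof.
set z := \val _; apply/eqP => zreal.
have : evZ ('X^2 - 1) z == 0.
  rewrite rmorphB /= map_polyXn rmorph1 hornerD hornerN hornerXn hornerC.
  by rewrite expr2 {2}zreal -sqr_normc conjugate_norm expr1n subrr.
rewrite -conjugates_morph rmorphB /= map_polyXn rmorph1 hornerD hornerN.
by rewrite hornerXn hornerC subr_eq0; apply/negP; apply: zeta_sqr_neq1.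
Qed.

Lemma val_ratr (r : rat) : \val (ratr r : cyclotomic R n) = ratr r.
Proof. by rewrite /ratr fmorph_div !rmorph_int. Qed.

Lemma cyc_fraction (x : cyclotomic R n) : exists p q : {poly rat},
  x = (map_poly ratr p).[zeta_cyc] / (map_poly ratr q).[zeta_cyc].
Proof.
have /asboolP[p [q [_ xpq]]] := cyclotomic_valP x.
exists p, q; apply: val_inj; rewrite fmorph_div -!horner_map -!map_poly_comp.
by rewrite !(@eq_map_poly _ _ (\val \o ratr) ratr val_ratr).
Qed.

Lemma val_gal_fraction (s : {rmorphism cyclotomic R n -> cyclotomic R n}) p q :
  cyclotomic_gal s ->
  \val (s ((map_poly ratr p).[zeta_cyc] / (map_poly ratr q).[zeta_cyc])) =
  (map_poly ratr p).[ \val (s zeta_cyc)] /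
  (map_poly ratr q).[ \val (s zeta_cyc)].
Proof.
move=> [_ sQ].
have evQ (r : {poly rat}) : \val (s (map_poly ratr r).[zeta_cyc]) =
    (map_poly ratr r).[ \val (s zeta_cyc)].
  rewrite -!horner_map -!map_poly_comp; congr (_.[_]).
  by apply: eq_map_poly => a; rewrite -[LHS]/(\val (s (ratr a))) sQ val_ratr.
by rewrite -!evQ; exact: (fmorph_div (\val \o s)).
Qed.

Lemma evQ_conj (p : {poly rat}) (z : R[i]) :
  (map_poly ratr p).[z^*] = ((map_poly ratr p).[z])^*.
Proof.
rewrite -[in RHS]horner_map /= -map_poly_comp /=; congr (_.[_]).
by apply: eq_map_poly => a /=; rewrite /ratr fmorph_div !rmorph_int.
Qed.

Variable s : 'I_(star_dim n).+1 -> {rmorphism cyclotomic R n -> cyclotomic R n}.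
Hypothesis s_star : star_choice s.

Let y i : R[i] := \val (s i zeta_cyc).

(** The star map has one automorphism in each conjugate pair, so two of its
    automorphisms that agree up to conjugation have the same index. *)
Lemma star_choice_inj i j :
  s i =1 s j \/ conjugate_to (s i) (s j) -> i = j.
Proof.
case: s_star => _ gal uniq ij; have [k [_ kP]] := uniq _ (gal j).
by rewrite -(kP i ij) -(kP j) //; left.
Qed.

Lemma conjugates_inj : injective y.
Proof.
case: s_star => _ gal _ i j; rewrite /y => eqij.
apply: star_choice_inj; left => x.
have [p [q ->]] := cyc_fraction x; apply: val_inj.
by rewrite !val_gal_fraction // eqij.
Qed.

Lemma conjugates_neq_conj i j : y i != (y j)^*.
Proof.
case: s_star => _ gal _; apply/eqP => eqij.
suff ij : i = j by move: eqij; rewrite ij; apply/eqP/conjugate_nonreal.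
apply: star_choice_inj; right => x.
have [p [q ->]] := cyc_fraction x; rewrite !val_gal_fraction //.
by rewrite -/(y i) -/(y j) eqij !evQ_conj -fmorph_div.
Qed.

Lemma conjugate0 : y ord0 = zeta R n.
Proof. by case: s_star => s0 _ _; rewrite /y s0. Qed.

(** * Density of the star map and small real multiples *)

Lemma star_small (e : R) : 0 < e -> exists2 p : {poly int},
  evZ p (zeta R n) != 0 & forall i, `|evZ p (y (lift ord0 i))| <= e%:C.
Proof.
move=> e0; rewrite -conjugate0.
apply: (@small_conjugates _ _ _ (fun i => y (lift ord0 i))) => //.
- by move=> i; apply: conjugate_norm.
- by move=> i j /conjugates_inj/lift_inj.
- by move=> i j; apply: conjugates_neq_conj.
- by move=> i; rewrite (inj_eq conjugates_inj) neq_lift.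
- by move=> i; apply: conjugates_neq_conj.
- by move=> p i; rewrite conjugate0 (conjugates_morph (s (lift ord0 i))).
Qed.

Lemma star_dense (w : 'I_(star_dim n) -> R[i]) (e : R) : 0 < e ->
  exists p : {poly int}, forall i, `|evZ p (y (lift ord0 i)) - w i| <= e%:C.
Proof.
move=> e0.
apply: (@dense_conjugates _ _ (y ord0) (fun i => y (lift ord0 i))) => //.
- by move=> i; apply: conjugate_norm.
- by move=> i j /conjugates_inj/lift_inj.
- by move=> i j; apply: conjugates_neq_conj.
- by move=> i; rewrite (inj_eq conjugates_inj) neq_lift.
- by move=> i; apply: conjugates_neq_conj.
- by move=> p i; rewrite conjugate0 (conjugates_morph (s (lift ord0 i))).
Qed.

(** Multiples [m * |q(zeta)|^2 * P(zeta)], with [q] from [star_small].  The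
    factor q(zeta) times its complex conjugate is real, and its image at each
    conjugate is again a squared modulus.  Avoiding the finite set [D] is
    ensured by trying [size D + 1] distinct values of [m]: their number is
    known before [q] is chosen, so smallness can be asked for all of them. *)
Lemma small_multiple (e : R) (P : {poly int}) (D : seq R[i]) :
  0 < e -> evZ P (zeta R n) != 0 -> exists (r : R) (p : {poly int}),
  [/\ evZ p (zeta R n) = r%:C * evZ P (zeta R n), evZ p (zeta R n) \notin D
    & forall i, `|evZ p (y (lift ord0 i))| <= e%:C].
Proof.
move=> e0 P0; set M := (size D).+1.
pose nrm (z : R[i]) := complex.Re `|z|.
have nrmE z : (nrm z)%:C = `|z| by rewrite RRe_real // normr_real.
have nrm_ge0 z : 0 <= nrm z by rewrite -ler0c nrmE.
have [B B0 BP] : exists2 B : R, 0 < B &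
    forall i, `|evZ P (y (lift ord0 i))| <= B%:C.
  exists (1 + \sum_i nrm (evZ P (y (lift ord0 i)))).
    by rewrite ltr_wpDr // sumr_ge0.
  move=> i; rewrite -nrmE lecR (bigD1 i) //= addrCA lerDl addr_ge0 //.
  exact: sumr_ge0.
pose f := Num.min 1 (e / B / M%:R).
have f0 : 0 < f by rewrite lt_min ltr01 !divr_gt0 ?ltr0n.
have [q q0 qP] := star_small f0.
(* Evaluating q at the power [n.-1] of y_i conjugates its value. *)
pose N := q * (q \Po 'X^(n.-1)) * P.
have NE i : evZ N (y i) = `|evZ q (y i)| ^+ 2 * evZ P (y i).
  rewrite !rmorphM !hornerM /= map_comp_poly map_polyXn horner_comp hornerXn.
  by rewrite -conjugate_conj evZ_conj -sqr_normc.
have N0 : evZ N (zeta R n) != 0.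
  by rewrite -conjugate0 NE conjugate0 mulf_neq0 // expf_neq0 // normr_eq0.
have mE (z : R[i]) (m : nat) : evZ (N *+ m) z = evZ N z *+ m.
  by rewrite rmorphMn hornerMn.
have [m mM mD] : exists2 m, (m <= M)%N & evZ N (zeta R n) *+ m \notin D.
  apply: contrapT => noM.
  have sub : {subset [seq evZ N (zeta R n) *+ m | m <- iota 0 M] <= D}.
    move=> x /mapP[m]; rewrite mem_iota => /andP[_ mM] ->.
    by apply: contrapT => /negP mD; apply: noM; exists m; rewrite // ltnW.
  have := uniq_leq_size _ sub; rewrite size_map size_iota ltnn => H.
  apply: notF; apply: H; rewrite map_inj_uniq ?iota_uniq // => a b.
  by move/(mulrIn N0).
exists ((nrm (evZ q (zeta R n)) ^+ 2) *+ m), (N *+ m); split.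
- by rewrite mE -conjugate0 NE rmorphMn rmorphXn /= mulrnAl nrmE.
- by rewrite mE.
move=> i; rewrite mE normrMn NE normrM normrX normr_id.
apply: (@le_trans _ _ ((f * B) *+ m)%:C).
  rewrite rmorphMn rmorphM /= lerMn2r; apply/orP; right; apply: ler_pM => //.
  rewrite expr2; apply: le_trans (ler_piMr _ _) (qP i) => //.
  by apply: le_trans (qP i) _; rewrite (lecR f 1) ge_min lexx.
rewrite lecR -mulr_natr; apply: (@le_trans _ _ (e / B / M%:R * B * M%:R)).
  rewrite ler_pM ?ler_nat ?mulr_ge0 ?(ltW f0) ?(ltW B0) //.
  by rewrite ler_wpM2r ?(ltW B0) // ge_min lexx orbT.
have M0 : M%:R != 0 :> R by rewrite pnatr_eq0.
suff -> : e / B / M%:R * B * M%:R = e by [].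
by field; rewrite M0 gt_eqF.
Qed.

(** * Model sets with open windows *)

Variables (t : R[i]) (O : set 'rV[R[i]^o]_(star_dim n)).
Hypothesis O_open : open O.

Lemma open_entries w : O w -> exists2 e : R, 0 < e &
  forall w' : 'rV[R[i]^o]_(star_dim n),
  (forall i, `|w ord0 i - w' ord0 i| <= e%:C) -> O w'.
Proof.
move=> Ow; have /nbhs_ballP[e /= e0 eO] := open_nbhs_nbhs (conj O_open Ow).
have eE : e = (complex.Re e)%:C by rewrite RRe_real // gtr0_real.
have r0 : 0 < complex.Re e by rewrite -ltcR -eE.
exists (complex.Re e / 2); first by rewrite divr_gt0.
move=> w' ww'; apply: eO; split=> // i j; rewrite (ord1 i).
apply: le_lt_trans (ww' j) _.
by rewrite eE ltcR; lra.
Qed.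

Lemma star_cyc_of_poly p i :
  star s (cyc_of_poly p) ord0 i = evZ p (y (lift ord0 i)).
Proof. by rewrite mxE val_morph_poly. Qed.

Lemma model_set_nonempty : (O !=set0)%classic ->
  (model_set s t O !=set0)%classic.
Proof.
move=> [w Ow]; have [e e0 eP] := open_entries Ow.
have [p pP] := star_dense (fun i => w ord0 i) e0.
exists (t + \val (cyc_of_poly p)), (cyc_of_poly p) => //; split.
  by exists p; rewrite val_cyc_of_poly.
by apply: eP => i; rewrite star_cyc_of_poly distrC.
Qed.

Lemma model_set_shift x : model_set s t O x -> exists2 e : R, 0 < e &
  forall p : {poly int}, (forall i, `|evZ p (y (lift ord0 i))| <= e%:C) ->
  model_set s t O (x + evZ p (zeta R n)).
Proof.
move=> [z [[q zq] Oz] <-]; have [e e0 eP] := open_entries Oz.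
exists e => // p pP.
have addE (f : {rmorphism cyclotomic R n -> cyclotomic R n}) :
    \val (f (z + cyc_of_poly p)) = \val (f z) + evZ p (\val (f zeta_cyc)).
  by rewrite -val_morph_poly !rmorphD.
have val_add : \val (z + cyc_of_poly p) = \val z + evZ p (zeta R n).
  exact: (addE idfun).
exists (z + cyc_of_poly p); last by rewrite val_add addrA.
split; first by exists (q + p); rewrite val_add zq rmorphD hornerD.
apply: eP => i; rewrite !mxE addE opprD addNKr normrN; exact: pP.
Qed.

End RootOfUnity.

(** A finite subset of the model set needs one radius valid at all its
    points. *)
Lemma finite_uniform_radius (R : realType) (T : eqType) (A : seq T)
    (Q : T -> R -> Prop) :
  (forall x e e', Q x e -> e' <= e -> Q x e') ->
  (forall x, x \in A -> exists2 e, 0 < e & Q x e) ->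
  exists2 e, 0 < e & forall x, x \in A -> Q x e.
Proof.
move=> Qmono; elim: A => [_|x A IH QA]; first by exists 1.
have [e e0 Qe] := QA x (mem_head _ _).
have [|f f0 Qf] := IH.
  by move=> a aA; apply: QA; rewrite inE aA orbT.
exists (Num.min e f); first by rewrite lt_min e0.
move=> a; rewrite inE => /predU1P[->|aA].
  by apply: Qmono Qe _; rewrite ge_min lexx.
by apply: Qmono (Qf a aA) _; rewrite ge_min lexx orbT.
Qed.

Theorem proposition8 (R : realType) (n : nat) (hn : (2 < n)%N)
    (L : set R[i]) (hL : cyclotomic_model_sets n L)
    (U : {fset R[i]})
    (hU : forall u, u \in U -> cyclotomic_direction n u)
    (hUpar : forall u v, u \in U -> v \in U -> u <> v -> ~ parallel u v) :
  ~ determined (finite_subsets L) U.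
Proof.
case: hL => s [t [W [s_star [W_int W_sub _ _] ->]]].
have O_open := @open_interior _ W.
pose S := model_set s t (W^°)%classic.
have S0 : (S !=set0)%classic by exact: model_set_nonempty.
have [F u SF uU|F [F' [SF SF' dFF' F0 eqF]]] := switching_component (U := U) S0.
  have [_ [_ [[P ->] P0 [r r0 uE]]]] := hU u uU.
  have [e e0 eP] : exists2 e : R, 0 < e & forall x, x \in (F : seq R[i]) ->
      forall p : {poly int},
      (forall i, `|(map_poly intr p).[ \val (s (lift ord0 i) (zeta_cyc R n))]|
         <= e%:C) -> S (x + (map_poly intr p).[zeta R n]).
    apply: finite_uniform_radius => [x e e' Qe le_e p pP|x xF].
      by apply: Qe => i; apply: le_trans (pP i) _; rewrite lecR.
    exact: model_set_shift (SF x xF).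
  (* Avoiding the differences of points of F means moving F off itself. *)
  have [c [p [pE pD p_small]]] :=
    small_multiple hn s_star [seq a - b | a <- F, b <- F] e0 P0.
  have vE : (c / r)%:C * u = (map_poly intr p).[zeta R n].
    by rewrite pE uE mulrA -rmorphM divfK.
  exists (c / r) => x xF; rewrite vE; split; first exact: eP.
  apply: contra pD => xpF.
  apply/allpairsP; exists (x + (map_poly intr p).[zeta R n], x).
  by split=> //=; rewrite addrAC subrr add0r.
move=> /(_ F F') detF.
(* The construction took place in the interior of the window. *)
have sub (G : {fset R[i]}) : finite_subsets S G ->
    finite_subsets (model_set s t W) G.
  by move=> SG x /SG [z [zZ zW] <-]; exists z => //; split=> //; apply: W_sub.
have eqFF' := detF (sub _ SF) (sub _ SF') eqF.
move: dFF' F0; rewrite -eqFF'.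
by rewrite /fdisjoint fsetIid => ->.
Qed.
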